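(* Suppose that the disturbance distribution has a finite support of the form $\mathbb{W}=\{\boldsymbol{w}^{(i)}\in\mathbb{R}^l \mid i=1,\dots,N\}$. Let $v_t$ be the value functions of the safety risk-constrained stochastic optimal control problem (defined in the context). Then the Bellman equation $$v_t(\boldsymbol{x})=\inf_{\boldsymbol{u}\in\mathbb{U},\,z\in\mathbb{R}}\Big\{ r(\boldsymbol{x},\boldsymbol{u})+\mathbb{E}\big[v_{t+1}(f(\boldsymbol{x},\boldsymbol{u},w_t))\big] \;:\; \mathbb{E}\Big[z+\frac{(\mathrm{dist}(f(\boldsymbol{x},\boldsymbol{u},w_t),A)-z)^+}{1-\alpha}\Big]\le\delta\Big\}$$ for $t\in\mathcal{T}$, with $v_T(\boldsymbol{x})=q(\boldsymbol{x})$, is equivalent to $$v_t(\boldsymbol{x})=\inf_{\boldsymbol{u}\in\mathbb{U},\,y\in A^N,\,z\in\mathbb{R}}\Big\{ r(\boldsymbol{x},\boldsymbol{u})+\frac1N\sum_{i=1}^N v_{t+1}(f(\boldsymbol{x},\boldsymbol{u},\boldsymbol{w}^{(i)})) \;:\; z+\frac{\sum_{i=1}^N(\|f(\boldsymbol{x},\boldsymbol{u},\boldsymbol{w}^{(i)})-y^{(i)}\|-z)^+}{N(1-\alpha)}\le\delta\Big\}$$ for $t\in\mathcal{T}$, with $v_T(\boldsymbol{x})=q(\boldsymbol{x})$, where $y=(y^{(1)},\dots,y^{(N)})$.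
   Context: Setting. Consider the discrete-time stochastic system $x_{t+1}=f(x_t,u_t,w_t)$ with state $x_t\in\mathbb{R}^n$, control input $u_t\in\mathbb{U}$, where $\mathbb{U}\subseteq\mathbb{R}^m$ is a convex set, and stochastic disturbance $w_t\in\mathbb{W}\subseteq\mathbb{R}^l$ defined on a standard filtered probability space $(\Omega,\mathcal{F},\{\mathcal{F}_t\}_{t\ge0},\mathbb{P})$; $w_t$ is $\mathcal{F}_t$-measurable and thus so is $x_{t+1}$. The $\sigma$-algebra $\mathcal{F}_{t-1}$ represents the information collected up to stage $t-1$. The horizon is $T$, and $\mathcal{T}=\{0,1,\dots,T-1\}$. The functions $r:\mathbb{R}^n\times\mathbb{R}^m\to\mathbb{R}$ and $q:\mathbb{R}^n\to\mathbb{R}$ are the stage-wise and terminal cost functions. Safe set and distance. $A\subseteq\mathbb{R}^n$ is a convex and compact Borel set (the desired set for safety), and $\mathrm{dist}(\boldsymbol{x},A):=\inf_{y\in A}\|\boldsymbol{x}-y\|$. Parameters: $\alpha\in(0,1)$ and the risk tolerance $\delta\ge0$. Notation: $(a)^+=\max\{a,0\}$. Policies. $\Pi$ is the set of admissible control strategies $\pi=(\pi_0,\dots,\pi_{T-1})$, where $\pi_t$ is a stochastic kernel from $H_t$ to $\mathbb{U}$ with $\pi_t(\mathbb{U}\mid h_t)=1$ for all $h_t\in H_t$; $H_t$ is the set of histories up to stage $t$, with elements of the form $h_t=(x_0,w_0,\dots,x_{t-1},w_{t-1},x_t)$. $\mathbb{E}^\pi$ and $\mathrm{CVaR}^\pi_\alpha$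 are taken with respect to the probability measure induced by $\pi$. Risk measure. The conditional version of the conditional value-at-risk is the random variable adapted to $\mathcal{F}_{t-1}$ given by $$\mathrm{CVaR}_\alpha[\mathrm{dist}(x_{t+1},A)\mid\mathcal{F}_{t-1}]:=\min_{Z\in\mathcal{L}_2(\Omega,\mathcal{F}_{t-1},\mathbb{P})} Z+\mathbb{E}\Big[\frac{(\mathrm{dist}(x_{t+1},A)-Z)^+}{1-\alpha}\,\Big|\,\mathcal{F}_{t-1}\Big].$$ Value functions. $v_T:=q$ and, for $t\in\mathcal{T}$, $$v_t(\boldsymbol{x}) := \inf_{\pi\in\Pi}\Big\{\mathbb{E}^\pi\Big[\sum_{s=t}^{T-1} r(x_s,u_s)+q(x_T)\,\Big|\,x_t=\boldsymbol{x}\Big] \;:\; \mathrm{CVaR}^\pi_\alpha[\mathrm{dist}(x_{s+1},A)\mid\mathcal{F}_{s-1}]\le\delta,\ s\in\{t,t+1,\dots,T-1\}\Big\}.$$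
   Formalization: The disturbance is assumed uniformly distributed on its finite support, each w^(i) having probability 1/N (repeated points adding weights), since the claim fails for other weights; the set A is also assumed nonempty. *)

(* Defs.v *)
From HB Require Import structures.
From mathcomp Require Import all_boot all_order all_algebra.
From mathcomp Require Import all_classical all_reals all_analysis.

Set Implicit Arguments.
Unset Strict Implicit.
Unset Printing Implicit Defensive.

Import Order.TTheory GRing.Theory Num.Theory.
Import numFieldNormedType.Exports.

Local Open Scope classical_set_scope.
Local Open Scope ring_scope.

(* The library norm on ['rV[R]_n] is the sup norm, hence this definition. *)
Definition enorm (R : realType) (n : nat) (x : 'rV[R]_n) : R :=
  Num.sqrt (\sum_(i < n) x ord0 i ^+ 2).

(* Meaningful for nonempty [A] only: the library sets [inf set0 = 0]. *)
Definition dist (R : realType) (n : nat) (x : 'rV[R]_n) (A : set 'rV[R]_n) : R :=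
  inf [set enorm (x - y) | y in A].

Definition pos_part (R : realType) (a : R) : R := Num.max a 0.

(* ['rV[R]_n] with its Borel sigma-algebra. *)
Definition borel (R : realType) (n : nat) :=
  g_sigma_algebraType (@open 'rV[R]_n).

Section conditioning.
Context d (Omega : measurableType d) (R : realType).

Definition filtration (F : nat -> set (set Omega)) : Prop :=
  [/\ forall t, sigma_algebra [set: Omega] (F t),
      forall t, F t `<=` measurable &
      forall s t, (s <= t)%N -> F s `<=` F t].

Definition measurable_wrt (G : set (set Omega)) d' (T : measurableType d')
    (X : Omega -> T) : Prop :=
  forall B : set T, measurable B -> G (X @^-1` B).

Variables (P : probability Omega R) (G : set (set Omega)).

(* [Y] is a version of E[X | G]. *)
Definition is_cond_expectation (X Y : Omega -> R) : Prop :=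
  [/\ P.-integrable [set: Omega] (EFin \o X),
      measurable_wrt G Y,
      P.-integrable [set: Omega] (EFin \o Y) &
      forall E : set Omega, G E ->
        (\int[P]_(w in E) (Y w)%:E = \int[P]_(w in E) (X w)%:E)%E].

Definition in_L2 (Z : Omega -> R) : Prop :=
  measurable_wrt G Z /\ finite_norm P 2%:E Z.

(* [C] is a version of Z + E[(D - Z)^+ / (1 - alpha) | G]. *)
Definition is_cvar_objective (alpha : R) (D Z C : Omega -> R) : Prop :=
  exists Y : Omega -> R,
    is_cond_expectation (fun w => pos_part (D w - Z w) / (1 - alpha)) Y /\
    C = Z \+ Y.

(* [C] is a version of CVaR_alpha[D | G]: the minimum over Z in L2(G) is an
   attained minimum of random variables for the almost sure order, so it is
   determined up to almost sure equality. *)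
Definition is_cond_cvar (alpha : R) (D C : Omega -> R) : Prop :=
  (exists Z, in_L2 Z /\ is_cvar_objective alpha D Z C) /\
  (forall Z C', in_L2 Z -> is_cvar_objective alpha D Z C' ->
     {ae P, forall w, C w <= C' w}).

(* If D >= 0, delta >= 0, and the essential infimum of the objectives is a.s.
   at most delta, then D is integrable and a conditional alpha-quantile of D,
   which lies in [0, delta], attains it; so asking for an attained minimum
   excludes nothing here. *)
Definition cond_cvar_le (alpha : R) (D : Omega -> R) (delta : R) : Prop :=
  exists C : Omega -> R,
    is_cond_cvar alpha D C /\ {ae P, forall w, C w <= delta}.

Definition has_expectation (X : Omega -> R) : Prop :=
  measurable_fun [set: Omega] X /\
  ((\int[P]_w (pos_part (X w))%:E < +oo)%E \/
   (\int[P]_w (pos_part (- X w))%:E < +oo)%E).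

End conditioning.

Section problem.
Variables (R : realType) (n m l T : nat).

(* h_s = (x_0, w_0, ..., x_(s-1), w_(s-1), x_s), stored as the tuple of states
   and the tuple of disturbances. *)
Definition history (s : nat) : Type :=
  ((s.+1).-tuple (borel R n) * s.-tuple (borel R l))%type.

Definition history_of (Omega : Type) (X : nat -> Omega -> 'rV[R]_n)
    (W : nat -> Omega -> 'rV[R]_l) (s : nat) (o : Omega) : history s :=
  ([tuple (X i o : borel R n) | i < s.+1],
   [tuple (W i o : borel R l) | i < s]).

Definition strategy : Type :=
  forall s : 'I_T,
    R.-pker ((s.+1).-tuple (borel R n) * s.-tuple (borel R l)) ~> (borel R m).

Variable U : set 'rV[R]_m.

(* pi_s(U | h) = 1; phrased with a Borel subset of [U] because a measure says
   nothing about non-Borel sets. For Borel [U] this is pi_s(U | h) = 1. *)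
Definition admissible (pi : strategy) : Prop :=
  forall (s : 'I_T) (h : history s),
    exists B : set (borel R m),
      [/\ measurable B, B `<=` U & pi s h B = 1%E].

Variables (f : 'rV[R]_n -> 'rV[R]_m -> 'rV[R]_l -> 'rV[R]_n)
  (A : set 'rV[R]_n) (r : 'rV[R]_n -> 'rV[R]_m -> R) (q : 'rV[R]_n -> R)
  (alpha delta : R).

Variables (d : measure_display) (Omega : measurableType d)
  (P : probability Omega R) (w : nat -> Omega -> 'rV[R]_l).

(* A realization of the closed-loop system under [pi], conditioned on x_t = x,
   on a space large enough to carry the randomized controls; [run_P] is the
   measure induced by [pi]. [run_F s] is the information F_(s-1) available when
   u_s is chosen. Given F_(s-1), the control u_s has law pi_s(. | h_s), and w_s
   is independent of it and of F_(s-1), with the law of the disturbance.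
   The part of the history before stage t is an arbitrary constant. *)
Record run (t : nat) (x : 'rV[R]_n) (pi : strategy) := Run {
  run_disp : measure_display;
  run_space : measurableType run_disp;
  run_P : probability run_space R;
  run_F : nat -> set (set run_space);
  run_x : nat -> run_space -> 'rV[R]_n;
  run_u : nat -> run_space -> 'rV[R]_m;
  run_w : nat -> run_space -> 'rV[R]_l;
  run_filtration : filtration run_F;
  run_x_adapted : forall s, (s <= T)%N ->
    measurable_wrt (run_F s) (run_x s : run_space -> borel R n);
  run_u_adapted : forall s, (t <= s < T)%N ->
    measurable_wrt (run_F s.+1) (run_u s : run_space -> borel R m);
  run_w_adapted : forall s, (s < T)%N ->
    measurable_wrt (run_F s.+1) (run_w s : run_space -> borel R l);
  run_past : forall s, (s < t)%N -> exists a b,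
    forall o, run_x s o = a /\ run_w s o = b;
  run_start : forall o, run_x t o = x;
  run_dynamics : forall s o, (t <= s < T)%N ->
    run_x s.+1 o = f (run_x s o) (run_u s o) (run_w s o);
  run_law : forall (s : 'I_T) (E : set run_space)
      (B : set (borel R m)) (C : set (borel R l)), (t <= s)%N ->
    run_F s E -> measurable B -> measurable C ->
    (run_P (E `&` run_u s @^-1` B `&` run_w s @^-1` C) =
     (\int[run_P]_(o in E) pi s (history_of run_x run_w s o) B)
     * P (w s @^-1` C))%E }.

Arguments run_F {t x pi} _ _.
Arguments run_x {t x pi} _ _ _.
Arguments run_u {t x pi} _ _ _.
Arguments run_w {t x pi} _ _ _.

Definition run_cost (t : nat) (x : 'rV[R]_n) (pi : strategy)
    (rho : run t x pi) (o : run_space rho) : R :=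
  \sum_(t <= s < T) r (run_x rho s o) (run_u rho s o) + q (run_x rho T o).

Arguments run_cost {t x pi} rho _.

Definition run_safe (t : nat) (x : 'rV[R]_n) (pi : strategy)
    (rho : run t x pi) : Prop :=
  forall s, (t <= s < T)%N ->
    cond_cvar_le (run_P rho) (run_F rho s) alpha
      (fun o => dist (run_x rho s.+1 o) A) delta.

(* Two runs of the same [pi] from the same past have the same expected cost and
   the same conditional CVaR bounds, so letting the realization vary only makes
   the infimum independent of the choice of the underlying space. The infimum
   of an infeasible problem is +oo. *)
Definition value_function (t : nat) (x : 'rV[R]_n) : \bar R :=
  if (t < T)%N then
    ereal_inf [set c : \bar R | exists pi : strategy, exists rho : run t x pi,
      [/\ admissible pi, run_safe rho,
          has_expectation (run_P rho) (run_cost rho) &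
          c = 'E_(run_P rho)[run_cost rho]%E]]
  else (q x)%:E.

Definition bellman_rhs (V : 'rV[R]_n -> \bar R) (t : nat) (x : 'rV[R]_n)
    : \bar R :=
  ereal_inf [set c : \bar R | exists (u : 'rV[R]_m) (z : R),
    [/\ U u,
        ('E_P[(fun o => z + pos_part (dist (f x u (w t o)) A - z) / (1 - alpha))%R]
           <= delta%:E)%E &
        c = ((r x u)%:E + \int[P]_o V (f x u (w t o)))%E]].

Definition bellman_equation (v : nat -> 'rV[R]_n -> \bar R) : Prop :=
  (forall x, v T x = (q x)%:E) /\
  (forall t x, (t < T)%N -> v t x = bellman_rhs (v t.+1) t x).

Variables (N : nat) (ws : 'I_N -> 'rV[R]_l).

Definition finite_bellman_rhs (V : 'rV[R]_n -> \bar R) (x : 'rV[R]_n)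
    : \bar R :=
  ereal_inf [set c : \bar R |
    exists (u : 'rV[R]_m) (y : 'I_N -> 'rV[R]_n) (z : R),
    [/\ U u,
        forall i, A (y i),
        z + (\sum_(i < N) pos_part (enorm (f x u (ws i) - y i) - z))
              / (N%:R * (1 - alpha)) <= delta &
        c = ((r x u)%:E + (N%:R^-1)%:E * \sum_(i < N) V (f x u (ws i)))%E]].

Definition finite_bellman_equation (v : nat -> 'rV[R]_n -> \bar R) : Prop :=
  (forall x, v T x = (q x)%:E) /\
  (forall t x, (t < T)%N -> v t x = finite_bellman_rhs (v t.+1) x).

(* The support of each disturbance is {w^(1), ..., w^(N)} with the uniform
   weights 1/N; a point listed several times gets the sum of its weights. *)
Definition uniform_finite_support : Prop :=
  forall t, (t < T)%N ->
    (forall o, exists i, w t o = ws i) /\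
    (forall i, P (w t @^-1` [set ws i]) =
               (#|[pred j | ws j == ws i]|%:R / N%:R)%:E).

End problem.

(* Main.v *)
Require Import Defs.
From HB Require Import structures.
From mathcomp Require Import all_boot all_order all_algebra.
From mathcomp Require Import all_classical all_reals all_analysis.
From mathcomp Require Import measurable_realfun.

Set Implicit Arguments.
Unset Strict Implicit.
Unset Printing Implicit Defensive.

Import Order.TTheory GRing.Theory Num.Theory.
Import numFieldNormedType.Exports.

Local Open Scope classical_set_scope.
Local Open Scope ring_scope.

(** Both right-hand sides are infima, and the two sets of admissible values
coincide, for every continuation [V] with values in the extended reals; the
equivalence of the two recursions is then immediate.

Two facts identify these sets. First, a random variable distributed uniformly
over a finite family [s] satisfies E[g(X)] = 1/N sum_i g(s_i) for every [g]
into the extended reals ([integral_uniform]), since [g \o X] takes finitely many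
values on measurable pieces; this rewrites both the objective and the
constraint. Second, [A] is compact, so the distance to [A] is attained
([dist_attained]): the auxiliary point y_i can be taken to be a nearest point of
[A] to the i-th successor state, which turns the norm into the distance. Conversely any y_i in [A] overestimates the distance, and
the constraint is monotone in it, so the y-constraint implies the one with
distances. *)

(** * Uniform laws on finite families *)

(** Even when both infinities occur among the [g i] there is no ambiguity: -oo
absorbs +oo in sums of extended reals, so each side is -oo. *)
Lemma sume_funeposneg (R : realType) (I : finType) (g : I -> \bar R) :
  (\sum_i g^\+ i - \sum_i g^\- i = \sum_i g i)%E.
Proof.
have [/existsP[i /eqP gi]|/existsPn gfin] := boolP [exists i, g i == -oo%E].
  have -> : (\sum_i g i = -oo)%E.
    by apply/esum_eqNyP; exists i; rewrite mem_index_enum.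
  suff -> : (\sum_i g^\- i = +oo)%E by rewrite addeNy.
  apply/esum_eqyP.
    by move=> j _; rewrite gt_eqF// (lt_le_trans _ (funeneg_ge0 _ _))// ltNy0.
  by exists i; rewrite mem_index_enum funenegE gi maxye.
rewrite -fin_num_sumeN; last first.
  move=> i _; rewrite funenegE; have := gfin i.
  by case: (g i) => //= [x|] _; rewrite -?EFin_max//= maxNye.
rewrite -big_split/=; apply: eq_bigr => i _.
by rewrite [in RHS](funeposneg g).
Qed.

Section uniform.
Context d (Omega : measurableType d) (R : realType) (P : probability Omega R).
Variables (V : eqType) (N : nat) (s : 'I_N -> V) (X : Omega -> V).
Hypothesis X_range : forall o, exists i, X o = s i.
Hypothesis X_measurable : forall i, measurable (X @^-1` [set s i]).
Hypothesis X_law : forall i,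
  P (X @^-1` [set s i]) = (#|[pred j | s j == s i]|%:R / N%:R)%:E.

Lemma uniform_size_gt0 : (0 < N)%N.
Proof.
have [pt _] : [set: Omega] !=set0.
  apply/set0P/eqP => T0; have := @probability_setT _ _ _ P.
  by rewrite T0 measure0 => /esym/eqP; rewrite onee_eq0.
by have [i _] := X_range pt; exact: leq_ltn_trans (ltn_ord i).
Qed.

Let mult i := #|[pred j | s j == s i]|.

Let mult_gt0 i : (0 < mult i)%N.
Proof. by apply/card_gt0P; exists i; rewrite inE. Qed.

(** The indices [i] with [s i = X o] are [mult i] in number, so weighting each
by 1 / [mult i] counts the value [g (X o)] once; this cancels the multiplicity in
the law of [X] and avoids enumerating the distinct values of [s]. *)
Let uniform_decomposition (g : V -> \bar R) o : (forall v, 0 <= g v)%E ->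
  g (X o) = (\sum_(i < N) ((mult i)%:R^-1%:E * g (s i))
                 * (\1_(X @^-1` [set s i]) o)%:E)%E.
Proof.
move=> g0; have [k Xk] := X_range o.
rewrite (bigID (fun i => s i == s k))/= [X in (_ + X)%E]big1 ?adde0; last first.
  move=> i sik; rewrite indicE memNset ?mule0//= Xk.
  by apply/eqP; rewrite eq_sym.
rewrite (eq_bigr (fun=> (mult k)%:R^-1%:E * g (s k)))%E; last first.
  move=> i /eqP sik; rewrite indicE mem_set ?mule1/= ?Xk ?sik//.
  by rewrite /mult sik.
rewrite -ge0_sume_distrl; last by move=> i _; rewrite lee_fin invr_ge0.
rewrite sumEFin sumr_const -[_ *+ _]mulr_natl -/(mult k).
by rewrite divff ?mul1e ?Xk// pnatr_eq0 -lt0n.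
Qed.

Let ge0_integral_uniform (g : V -> \bar R) : (forall v, 0 <= g v)%E ->
  (\int[P]_o g (X o) = (N%:R^-1)%:E * \sum_(i < N) g (s i))%E.
Proof.
move=> g0.
under eq_integral do rewrite (uniform_decomposition _ g0).
have h0 i : (0 <= (mult i)%:R^-1%:E * g (s i))%E.
  by rewrite mule_ge0// lee_fin invr_ge0.
have m1 i : measurable_fun [set: Omega]
    (fun o => (\1_(X @^-1` [set s i]) o)%:E : \bar R).
  by apply/measurable_EFinP; exact: measurable_indic.
rewrite ge0_integral_sum//; last 2 first.
- by move=> i; apply: emeasurable_funM => //; exact: measurable_cst.
- by move=> i o _; rewrite mule_ge0// lee_fin.
rewrite ge0_sume_distrr//; apply: eq_bigr => i _.
rewrite ge0_integralZl//.
rewrite integral_indic// setIT [X in (_ * X)%E](X_law i).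
rewrite -/(mult i) muleC muleA -EFinM.
by rewrite mulrAC divff ?mul1r// pnatr_eq0 -lt0n.
Qed.

(** The nonnegative case applies to the positive and negative parts of [g], and
the finite sum recombines them as the integral does. *)
Lemma integral_uniform (g : V -> \bar R) :
  (\int[P]_o g (X o) = (N%:R^-1)%:E * \sum_(i < N) g (s i))%E.
Proof.
rewrite integralE.
transitivity ((N%:R^-1)%:E * \sum_(i < N) (g \o s)^\+ i -
              (N%:R^-1)%:E * \sum_(i < N) (g \o s)^\- i)%E.
  congr (_ - _)%E.
    under eq_integral do rewrite (funepos_comp g X).
    rewrite ge0_integral_uniform; last by move=> v; exact: funepos_ge0.
    by congr (_ * _)%E; apply: eq_bigr => i _; rewrite !funeposE.
  under eq_integral do rewrite (funeneg_comp g X).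
  rewrite ge0_integral_uniform; last by move=> v; exact: funeneg_ge0.
  by congr (_ * _)%E; apply: eq_bigr => i _; rewrite !funenegE.
have N0 : (0 < N%:R^-1 :> R) by rewrite invr_gt0 ltr0n uniform_size_gt0.
rewrite -(sume_funeposneg (g \o s)).
set b := (\sum_(i < N) (g \o s)^\- i)%E.
have : (0 <= b)%E by apply: sume_ge0 => i _; exact: funeneg_ge0.
(* an infinite negative part forces -oo on both sides *)
case: b => [b _|_|//];
  last by rewrite gt0_muley ?lte_fin// !addeNy gt0_muleNy ?lte_fin.
by rewrite muleBr// fin_num_adde_defl.
Qed.

End uniform.

(** * Distance to a compact set *)

Lemma enorm_ge0 (R : realType) n (x : 'rV[R]_n) : 0 <= enorm x.
Proof. exact: sqrtr_ge0. Qed.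

Lemma dist_le_enorm (R : realType) n (x y : 'rV[R]_n) (A : set 'rV[R]_n) :
  A y -> dist x A <= enorm (x - y).
Proof.
move=> Ay; apply: ge_inf; last by exists y.
by exists 0 => _ [z _ <-]; exact: enorm_ge0.
Qed.

Lemma continuous_enormB (R : realType) n (x : 'rV[R]_n) :
  continuous (fun y : 'rV[R]_n => enorm (x - y)).
Proof.
move=> y; apply: (@continuous_comp _ _ _
  (fun y : 'rV[R]_n => \sum_(i < n) (x - y) ord0 i ^+ 2) (@Num.sqrt R));
  last exact: sqrt_continuous.
apply: (continuous_big (P := xpredT)) => [|i _ {}y].
  exact: add_continuous.
rewrite [X in continuous_at _ X](_ : _ = fun y : 'rV[R]_n =>
    (x ord0 i - y ord0 i) * (x ord0 i - y ord0 i)); last first.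
  by apply/funext => z; rewrite !mxE expr2.
have coordB : {for y, continuous (fun y : 'rV[R]_n => x ord0 i - y ord0 i)}.
  by apply: continuousB; [exact: cst_continuous|exact: coord_continuous].
exact: (continuousM coordB coordB).
Qed.

Lemma dist_attained (R : realType) n (x : 'rV[R]_n) (A : set 'rV[R]_n) :
  A !=set0 -> compact A -> exists2 y, A y & enorm (x - y) = dist x A.
Proof.
move=> A0 cA.
have [|y /set_mem Ay ymin] :=
  @EVT_min_rV R n (fun y => enorm (x - y)) A A0 cA.
  by apply: continuous_subspaceT; exact: continuous_enormB.
exists y => //; apply/eqP; rewrite eq_le dist_le_enorm// andbT.
apply: lb_le_inf; first by exists (enorm (x - y)), y.
by move=> _ [z Az <-]; apply: ymin; exact: mem_set.
Qed.

(** * The Bellman operators *)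

Lemma borel_set1 (R : realType) n (v : 'rV[R]_n) :
  measurable ([set v] : set (borel R n)).
Proof.
have -> : [set v] = ~` (~` [set v]) by rewrite setCK.
apply: (@measurableC _ (borel R n)); apply: sub_sigma_algebra.
rewrite /= openC; apply: accessible_closed_set1.
by apply: hausdorff_accessible; exact: norm_hausdorff.
Qed.

Lemma ler_pos_part (R : realType) : {homo @pos_part R : a b / a <= b}.
Proof. by move=> a b ab; rewrite /pos_part ge_max !le_max ab lexx orbT. Qed.

(** The continuation [V] is arbitrary, so one stage can be compared in isolation:
both infima range over the same values, the transfer of expectations matching
objectives and risks, and nearest points of [A] matching norms and distances. *)
Lemma bellman_rhs_finite (R : realType) (n m l T : nat)
  (f : 'rV[R]_n -> 'rV[R]_m -> 'rV[R]_l -> 'rV[R]_n)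
  (U : set 'rV[R]_m) (A : set 'rV[R]_n)
  (r : 'rV[R]_n -> 'rV[R]_m -> R) (alpha delta : R)
  (d : measure_display) (Omega : measurableType d) (P : probability Omega R)
  (w : nat -> Omega -> 'rV[R]_l) (N : nat) (ws : 'I_N -> 'rV[R]_l)
  (V : 'rV[R]_n -> \bar R) (t : nat) (x : 'rV[R]_n) :
  A !=set0 -> compact A -> alpha < 1 ->
  measurable_fun [set: Omega] (w t : Omega -> borel R l) ->
  uniform_finite_support T P w ws -> (t < T)%N ->
  bellman_rhs U f A r alpha delta P w V t x =
  finite_bellman_rhs U f A r alpha delta ws V x.
Proof.
move=> A0 cA alpha1 mw + tT => /(_ t tT)[w_range w_law].
have mws i : measurable (w t @^-1` [set ws i]).
  by rewrite -[X in measurable X]setTI; exact: mw (borel_set1 _).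
have N0 : N%:R != 0 :> R.
  by rewrite pnatr_eq0 -lt0n (uniform_size_gt0 P w_range).
have alpha0 : 0 < 1 - alpha by rewrite subr_gt0.
have transfer g := integral_uniform w_range mws w_law g.
have risk u z :
    ('E_P[(fun o => z + pos_part (dist (f x u (w t o)) A - z) / (1 - alpha))%R] =
    (z + (\sum_(i < N) pos_part (dist (f x u (ws i)) A - z))
           / (N%:R * (1 - alpha)))%:E)%E.
  rewrite unlock.
  rewrite (transfer (fun v =>
    (z + pos_part (dist (f x u v) A - z) / (1 - alpha))%:E)).
  rewrite sumEFin -EFinM big_split/= sumr_const card_ord -mulr_suml; congr EFin.
  by rewrite -[z *+ N]mulr_natl mulrDr mulKf// invfM mulrCA.
have risk_mono z (e e' : 'I_N -> R) :
    (forall i, e i <= e' i) ->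
    z + (\sum_(i < N) pos_part (e i - z)) / (N%:R * (1 - alpha)) <=
    z + (\sum_(i < N) pos_part (e' i - z)) / (N%:R * (1 - alpha)).
  move=> ee'; rewrite lerD2l ler_wpM2r ?invr_ge0 ?mulr_ge0 ?(ltW alpha0)//.
  by apply: ler_sum => i _; apply: ler_pos_part; rewrite lerD2r.
rewrite /bellman_rhs /finite_bellman_rhs; congr ereal_inf.
apply/seteqP; split=> c /=.
  move=> [u [z [Uu + ->]]]; rewrite risk lee_fin => uz.
  (* nearest points of A to the successor states *)
  have /choice[y yP] i : exists y, A y /\
      enorm (f x u (ws i) - y) = dist (f x u (ws i)) A.
    by have [y Ay Ey] := dist_attained (f x u (ws i)) A0 cA; exists y.
  exists u, y, z; split=> //; first by move=> i; case: (yP i).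
    by under eq_bigr do rewrite (yP _).2.
  by rewrite (transfer (fun v => V (f x u v))).
move=> [u [y [z [Uu Ay uyz ->]]]]; exists u, z; split=> //.
  rewrite risk lee_fin (le_trans _ uyz)// risk_mono// => i.
  exact: dist_le_enorm.
by rewrite (transfer (fun v => V (f x u v))).
Qed.

Theorem theorem2 (R : realType) (n m l T : nat)
  (f : 'rV[R]_n -> 'rV[R]_m -> 'rV[R]_l -> 'rV[R]_n)
  (U : set 'rV[R]_m) (A : set 'rV[R]_n)
  (r : 'rV[R]_n -> 'rV[R]_m -> R) (q : 'rV[R]_n -> R) (alpha delta : R)
  (d : measure_display) (Omega : measurableType d) (P : probability Omega R)
  (F : nat -> set (set Omega)) (w : nat -> Omega -> 'rV[R]_l)
  (N : nat) (ws : 'I_N -> 'rV[R]_l)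
  (U_convex : convex_set U)
  (A_nonempty : A !=set0) (A_convex : convex_set A) (A_compact : compact A)
  (alpha_01 : 0 < alpha < 1) (delta_ge0 : 0 <= delta)
  (F_filtration : filtration F)
  (w_adapted : forall t, (t < T)%N ->
     measurable_wrt (F t) (w t : Omega -> borel R l))
  (w_finite : uniform_finite_support T P w ws) :
  let v := value_function T U f A r q alpha delta P w in
  (forall (t : nat) (x : 'rV[R]_n), (t < T)%N ->
     bellman_rhs U f A r alpha delta P w (v t.+1) t x =
     finite_bellman_rhs U f A r alpha delta ws (v t.+1) x) /\
  (bellman_equation T U f A r q alpha delta P w v <->
   finite_bellman_equation T U f A r q alpha delta ws v).
Proof.
move=> v.
have rhsE t x : (t < T)%N ->
    bellman_rhs U f A r alpha delta P w (v t.+1) t x =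
    finite_bellman_rhs U f A r alpha delta ws (v t.+1) x.
  move=> tT; apply: (@bellman_rhs_finite _ _ _ _ T) => //.
    by have /andP[] := alpha_01.
  move=> _ B mB; rewrite setTI.
  by have [_ sub _] := F_filtration; apply: (sub t); exact: w_adapted.
split=> //; split=> -[vT vt]; split=> // t x tT; rewrite vt//.
- exact: rhsE.
- exact/esym/rhsE.
Qed.
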